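(* For every $(2,3)$-bipartite graph $G$, $ch'_s(G)\leq 6$.
   Context: Graphs are finite and simple. A $(2,3)$-bipartite graph is a bipartite graph $G$ with a bipartition $(A,B)$ such that $\max\{\deg_G(v)\mid v\in A\}\le 2$ and $\max\{\deg_G(v)\mid v\in B\}\le 3$. A strong edge coloring of a graph $G$ is an edge coloring such that each color class is an induced matching of $G$. The list strong chromatic index $ch'_s(G)$ is the smallest integer $k$ such that for every list assignment $L$ on $E(G)$ satisfying $|L(e)|\ge k$ for all $e\in E(G)$, there is a strong edge coloring $\varphi$ of $G$ with $\varphi(e)\in L(e)$ for every edge $e$ of $G$. *)

(* Defs.v *)
From mathcomp Require Import all_boot finmap boolp.

Set Implicit Arguments.
Unset Strict Implicit.
Unset Printing Implicit Defensive.

Record sgraph := SGraph {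
  vertex :> finType;
  adj : rel vertex;
  adj_sym : symmetric adj;
  adj_irr : irreflexive adj
}.

Section Graph.
Variable G : sgraph.

Definition deg (v : G) : nat := #|[set w | adj v w]|.

Definition edges : {set {set G}} :=
  [set f | [exists x : G, [exists y : G, adj x y && (f == [set x; y])]]].

(* An edge is the set of its two endpoints. Colourings and lists are defined on
   the subtype of edges only, so that an edgeless graph is coloured vacuously
   even when the type of colours is empty. *)
Definition edge := {f : {set G} | f \in edges}.

Definition bipartition (A B : {set G}) : Prop :=
  [/\ A :|: B = [set: G], [disjoint A & B] &
      forall x y : G, adj x y ->
        (x \in A) && (y \in B) \/ (x \in B) && (y \in A)].

Definition bipartite23 : Prop :=
  exists A B : {set G},
    [/\ bipartition A B, \max_(v in A) deg v <= 2 & \max_(v in B) deg v <= 3].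

Definition matching (M : {set {set G}}) : Prop :=
  M \subset edges /\ trivIset M.

(* [cover M] is the set of vertices saturated by M, so the last condition says
   that the subgraph induced on it has no edges other than those of M. *)
Definition induced_matching (M : {set {set G}}) : Prop :=
  matching M /\ forall f, f \in edges -> f \subset cover M -> f \in M.

Definition color_class (C : eqType) (phi : edge -> C) (c : C) : {set {set G}} :=
  [set val f | f : edge & phi f == c].

Definition strong_edge_coloring (C : eqType) (phi : edge -> C) : Prop :=
  forall c : C, induced_matching (color_class phi c).

(* The colours range over an arbitrary type; no common set is fixed. *)
Definition strong_edge_choosable (k : nat) : Prop :=
  forall (C : choiceType) (L : edge -> {fset C}),
    (forall f, k <= #|` L f|%fset) ->
    exists phi : edge -> C,
      strong_edge_coloring phi /\ forall f, phi f \in L f.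

Lemma edge_card f : f \in edges -> #|f| = 2.
Proof.
rewrite inE => /existsP[x /existsP[y /andP[xy /eqP ->]]].
by rewrite cards2; case: eqP xy => // ->; rewrite adj_irr.
Qed.

Lemma injective_strong_edge_coloring (C : eqType) (phi : edge -> C) :
  injective phi -> strong_edge_coloring phi.
Proof.
move=> inj c; split; first split.
- by apply/subsetP => f /imsetP[g _ ->]; exact: valP.
- apply/trivIsetP => f g /imsetP[f' + ->] /imsetP[g' + ->].
  by rewrite !inE => /eqP <- /eqP /inj ->; rewrite eqxx.
- move=> f fE fM; have f2 := edge_card fE.
  have [x xf] : exists x, x \in f by apply/card_gt0P; rewrite f2.
  have /bigcupP[_ /imsetP[g gc ->] _] := subsetP fM _ xf.
  suff -> : f = val g by exact: imset_f.
  apply/eqP; rewrite eqEcard f2 edge_card ?(valP g) // andbT.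
  apply/subsetP => y /(subsetP fM) /bigcupP[_ /imsetP[h hc ->]].
  by move: gc hc; rewrite !inE => /eqP <- /eqP /inj ->.
Qed.

Lemma distinct_representatives (E : finType) (C : choiceType)
    (L : E -> {fset C}) :
  (forall e, #|E| <= #|` L e|%fset) ->
  exists f : E -> C, injective f /\ forall e, f e \in L e.
Proof.
move=> cL.
suff H (s : seq E) : uniq s -> exists f : E -> C,
    {in s &, injective f} /\ forall e, f e \in L e.
  have [f [fi fL]] := H _ (enum_uniq E); exists f; split=> // x y.
  by apply: fi; rewrite mem_enum.
elim: s => [_|e s IH /= /andP[es us]].
  have L0 e : exists c, c \in L e.
    apply/fset0Pn; rewrite -cardfs_gt0; apply: leq_trans (cL e).
    by apply/card_gt0P; exists e.
  by exists (fun e => xchoose (L0 e)); split=> // e; exact: xchooseP.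
have [f [fi fL]] := IH us.
have [c cLe cs] : exists2 c, c \in L e & c \notin map f s.
  case: (boolP (L e `<=` [fset x in map f s])%fset) => [sub|/fsubsetPn[c ce]].
    have := leq_trans (cL e) (fsubset_leq_card sub).
    rewrite card_fseq => /leq_trans /(_ (size_undup _)); rewrite size_map.
    have /card_uniqP se : uniq (e :: s) by rewrite /= es.
    by move=> /(leq_trans (max_card (mem (e :: s)))); rewrite se ltnn.
  by rewrite inE => cs; exists c.
exists (fun x => if x == e then c else f x); split; last first.
  by move=> x; case: eqP => [->|].
have fc x : x \in s -> f x <> c by move=> xs fx; rewrite -fx map_f in cs.
move=> x y; rewrite !inE.
case: (eqVneq x e) => [->|_] /=; case: (eqVneq y e) => [->|_] //= xs ys.
- by move=> /esym /fc; case.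
- by move=> /fc; case.
- exact: fi.
Qed.

Lemma strong_edge_choosable_card : strong_edge_choosable #|{: edge}|.
Proof.
move=> C L /distinct_representatives[phi [phi_inj phiL]].
by exists phi; split=> //; exact: injective_strong_edge_coloring.
Qed.

Lemma ex_strong_edge_choosable : exists k, `[< strong_edge_choosable k >].
Proof.
by exists #|{: edge}|; apply/asboolP; exact: strong_edge_choosable_card.
Qed.

Definition list_strong_chromatic_index : nat :=
  ex_minn ex_strong_edge_choosable.

Lemma list_strong_chromatic_indexP :
  strong_edge_choosable list_strong_chromatic_index /\
  forall k, strong_edge_choosable k -> list_strong_chromatic_index <= k.
Proof.
rewrite /list_strong_chromatic_index; case: ex_minnP => k /asboolP chk min_k.
by split=> // j /asboolP; exact: min_k.
Qed.

End Graph.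

(* Main.v *)
(* Let H be the subcubic multigraph whose vertices are the vertices in B and
   whose edges are the vertices in A. An edge ab of G is the flag (b, a) of H,
   seen as the edge a of H oriented away from b; two flags conflict iff they
   have the same tail or the head of one is the tail of the other. Colour the
   flags by induction on a set of edges of H: it suffices to remove some
   edges, colour the rest, and extend. If an edge is pendant or has an end of
   degree at most 2, it is removed and its flags are coloured greedily.
   Otherwise every end has degree 3, and what is removed is, for parallel
   edges uv, all edges at u; failing that, a triangle; failing that, the five
   edges at the ends of an edge uv, which then form a tree. In the last three
   cases the extension exists by the Alon-Tarsi form of the combinatorial
   Nullstellensatz: the product of the differences over the conflicting pairs
   of removed flags has a nonzero coefficient at a monomial whose exponents
   are smaller than the numbers of colours left to these flags. *)
Require Import Defs.
From mathcomp Require Import all_boot all_order all_algebra finmap.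

Set Implicit Arguments.
Unset Strict Implicit.
Unset Printing Implicit Defensive.

Import GRing.Theory Num.Theory.

(** * The Alon-Tarsi criterion for colouring from lists *)

(* The coefficient of the monomial with exponents [t] in the product of the
   ['X_a - 'X_b] over the pairs [(a, b)] in [E], provided [size E = sumn t]. *)
Fixpoint orientation_coef (E : seq (nat * nat)) (t : seq nat) : int :=
  if E is (a, b) :: E' then
    let dec i :=
      if nth 0 t i is k.+1 then orientation_coef E' (set_nth 0 t i k)
      else 0%R in
    (dec a - dec b)%R
  else 1%R.

Section Lagrange.
Local Open Scope ring_scope.
Variables (F : fieldType) (K : finType) (x : K -> F).
Hypothesis x_inj : injective x.

Lemma size_prod_XsubC_set (A : {set K}) :
  size (\prod_(k in A) ('X - (x k)%:P)) = #|A|.+1.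
Proof. by rewrite -big_enum size_prod_XsubC -cardE. Qed.

(** The sum is the coefficient of degree [#|A| - 1] in the Lagrange interpolant [q] of ['X^s] on
    [A], and [q] equals ['X^s] because both have degree below [#|A|]. *)
Lemma lagrange_sum (A : {set K}) (s : nat) : (s < #|A|)%N ->
  \sum_(j in A) x j ^+ s / (\prod_(k in A :\ j) (x j - x k))
    = (s.+1 == #|A|)%:R.
Proof.
move=> sA; pose w j := \prod_(k in A :\ j) (x j - x k).
have wn0 j : w j != 0.
  apply/prodf_neq0 => k; rewrite !inE subr_eq0 => /andP[kj _].
  by rewrite inj_eq // eq_sym.
pose l j := \prod_(k in A :\ j) ('X - (x k)%:P).
have sl j : j \in A -> size (l j) = #|A|.
  by move=> jA; rewrite size_prod_XsubC_set (cardsD1 j A) jA.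
pose q := \sum_(j in A) (x j ^+ s / w j) *: l j.
have sq : (size q <= #|A|)%N.
  apply: leq_trans (size_sum _ _ _) _; apply/bigmax_leqP => j jA.
  by apply: leq_trans (size_scale_leq _ _) _; rewrite sl.
have q_eq : q = 'X^s.
  apply/eqP; rewrite -subr_eq0; apply/eqP.
  apply: (@roots_geq_poly_eq0 _ _ [seq x j | j <- enum A]).
  - apply/allP => _ /mapP[j + ->]; rewrite mem_enum => jA.
    rewrite rootE !hornerE horner_sum (bigD1 j) //= big1 ?addr0.
      rewrite hornerZ horner_prod.
      have -> : \prod_(k in A :\ j) ('X - (x k)%:P).[x j] = w j.
        by apply: eq_bigr => k _; rewrite !hornerE.
      by rewrite divfK ?wn0 // subrr.
    move=> i /andP[iA ij]; rewrite hornerZ horner_prod (bigD1 j) /=.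
      by rewrite hornerXsubC subrr mul0r mulr0.
    by rewrite !inE jA eq_sym ij.
  - by rewrite map_inj_uniq // enum_uniq.
  rewrite size_map -cardE; apply: leq_trans (size_polyD _ _) _.
  by rewrite size_polyN size_polyXn geq_max sq.
have A0 : (0 < #|A|)%N by apply: leq_ltn_trans sA.
transitivity (q`_(#|A|.-1)); last first.
  by rewrite q_eq coefXn -{2}(prednK A0) eqSS eq_sym.
rewrite coef_sum; apply: eq_bigr => j jA; rewrite coefZ.
have /monicP : l j \is monic by apply: monic_prod_XsubC.
by rewrite lead_coefE sl // => ->; rewrite mulr1.
Qed.
End Lagrange.

Section Moment.
Local Open Scope ring_scope.
Variables (F : fieldType) (K : finType) (x : K -> F).
Hypothesis x_inj : injective x.
Variables (n : nat) (A : 'I_n.+1 -> {set K}) (t : seq nat).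
Hypothesis At : forall i : 'I_n.+1, #|A i| = (nth 0 t i).+1.

(* Summing against the Lagrange weights extracts the coefficient at the monomial
   with exponents [t] from a form of degree [\sum_i t_i]: any other monomial of
   that degree has an exponent smaller than the corresponding [t_i]. *)
Definition moment (s : 'I_n.+1 -> nat) (E : seq (nat * nat)) : F :=
  \sum_(c in family (fun i => mem (A i)))
    (\prod_i (x (c i) ^+ s i / \prod_(k in A i :\ c i) (x (c i) - x k))) *
    \prod_(e <- E) (x (c (inord e.1)) - x (c (inord e.2))).

Definition incr (s : 'I_n.+1 -> nat) (a : nat) (i : 'I_n.+1) : nat :=
  (s i + (i == inord a))%N.

Lemma moment_nil s : moment s [::] =
  \prod_i \sum_(j in A i) (x j ^+ s i / \prod_(k in A i :\ j) (x j - x k)).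
Proof.
rewrite bigA_distr_big_dep.
by apply: eq_bigr => c _; rewrite big_nil mulr1.
Qed.

Lemma moment_cons s a b E :
  moment s ((a, b) :: E) = moment (incr s a) E - moment (incr s b) E.
Proof.
have X (c : {ffun 'I_n.+1 -> K}) d :
    \prod_i (x (c i) ^+ incr s d i / \prod_(k in A i :\ c i) (x (c i) - x k))
  = x (c (inord d)) *
    \prod_i (x (c i) ^+ s i / \prod_(k in A i :\ c i) (x (c i) - x k)).
  rewrite (bigD1 (inord d)) //= [in RHS](bigD1 (inord d)) //= !mulrA.
  rewrite /incr eqxx addn1 exprS; congr (_ * _ * _).
  by apply: eq_bigr => i /negbTE ->; rewrite addn0.
rewrite /moment -sumrB; apply: eq_bigr => c _.
by rewrite big_cons !X /= -!mulrA -mulrBl mulrCA.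
Qed.

Lemma sum_incr s a : (\sum_i incr s a i = (\sum_i s i).+1)%N.
Proof.
rewrite /incr big_split /= -[in RHS]addn1; congr addn.
by rewrite (bigD1 (inord a)) //= eqxx big1 // => i /negbTE ->.
Qed.

(** Expanding [E] only raises exponents. The final total is that of [t], so if one exponent exceeds
    its share, another stays below its own and [lagrange_sum] gives 0. *)
Lemma moment_eq0 E s (i : 'I_n.+1) :
  (\sum_i s i + size E = \sum_(i < n.+1) nth 0 t i)%N -> (nth 0 t i < s i)%N ->
  moment s E = 0.
Proof.
elim: E s => [|[a b] E IH] s.
  rewrite addn0 => st ti; rewrite moment_nil.
  have [j sj] : exists j : 'I_n.+1, (s j < nth 0 t j)%N.
    apply/existsP; apply: contraLR isT; rewrite negb_exists => /forallP H.
    have : (\sum_i s i > \sum_(i < n.+1) nth 0 t i)%N.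
      rewrite (bigD1 i) //= [X in (_ < X)%N](bigD1 i) //= -addSn leq_add //.
      by apply: leq_sum => j _; rewrite leqNgt H.
    by rewrite st ltnn.
  apply/eqP; rewrite prodf_seq_eq0; apply/hasP.
  exists j; first exact: mem_index_enum.
  by rewrite /= lagrange_sum ?At ?eqSS ?ltn_eqF // ltnS ltnW.
move=> /= st ti; rewrite moment_cons !IH ?subr0 // ?sum_incr -?st ?addnS //.
  by rewrite (leq_trans ti) // leq_addr.
by rewrite (leq_trans ti) // leq_addr.
Qed.

(** Here [r] is the part of [t] not yet used up by [s]; the zero branch of [orientation_coef] is
    [moment_eq0]. *)
Lemma momentE E s (r : seq nat) :
  all (fun e => (e.1 <= n) && (e.2 <= n))%N E ->
  (\sum_i s i + size E = \sum_(i < n.+1) nth 0 t i)%N ->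
  (forall i : 'I_n.+1, (s i + nth 0 r i)%N = nth 0 t i) ->
  moment s E = (orientation_coef E r)%:~R.
Proof.
elim: E s r => [|[a b] E IH] s r /=.
  rewrite addn0 moment_nil => _ st sr; apply: big1 => i _.
  have ri : (nth 0 r i = 0)%N.
    move/eqP: st; under [X in _ == X]eq_bigr do rewrite -sr.
    rewrite big_split /= -[X in X == _]addn0 eqn_add2l eq_sym sum_nat_eq0.
    by move=> /forallP /(_ i) /eqP.
  have Ai : #|A i| = (s i).+1 by rewrite At -sr ri addn0.
  by rewrite lagrange_sum ?Ai ?eqxx.
move=> /andP[/andP[an bn] En] st sr; rewrite moment_cons rmorphB /=.
have X d : (d <= n)%N -> moment (incr s d) E =
    (if nth 0 r d is k.+1 then orientation_coef E (set_nth 0 r d k) else 0)%:~R.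
  move=> dn; have id : (inord d : 'I_n.+1) = d :> nat by rewrite inordK.
  have st' : (\sum_i incr s d i + size E = \sum_(i < n.+1) nth 0 t i)%N.
    by rewrite sum_incr -st addnS.
  case rd: (nth 0 r d) => [|k].
    rewrite (@moment_eq0 _ _ (inord d)) // /incr eqxx -sr id rd addn0.
    by rewrite addn1.
  apply: IH => // i; rewrite /incr nth_set_nth /= -(sr i) -val_eqE /= id.
  by case: eqP => [->|_]; rewrite ?rd ?addn0 // addnAC addn1 addnS.
by rewrite !X.
Qed.
End Moment.

Lemma alon_tarsi (C : choiceType) (L : nat -> {fset C}) (E : seq (nat * nat))
    (t : seq nat) :
  0 < size t -> all (fun e => (e.1 < size t) && (e.2 < size t)) E ->
  size E = sumn t ->
  orientation_coef E t != 0%R ->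
  (forall i, i < size t -> nth 0 t i < #|` L i|%fset) ->
  exists c : nat -> C, (forall i, i < size t -> c i \in L i) /\
    {in E, forall e, c e.1 != c e.2}.
Proof.
case: t => // t0 t _.
set n := size t => En Et coef0 Lt.
pose U := (\bigcup_(i <- iota 0 n.+1) L i)%fset.
have LU i : i <= n -> (L i `<=` U)%fset.
  by move=> ni; apply: bigfcup_sup; rewrite ?mem_iota.
(* Colours become distinct rationals; in characteristic 0 a nonzero integer coefficient stays
   nonzero. *)
pose x (u : U) : rat := (enum_rank u)%:R%R.
have x_inj : injective x.
  by move=> u v /eqP; rewrite eqr_nat => /eqP /val_inj /enum_rank_inj.
(* Lists are cut to exactly one colour more than the exponent, as the Lagrange sum requires. *)
have LA (i : 'I_n.+1) : exists A : {set U},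
    (#|A| == (nth 0 (t0 :: t) i).+1) && [forall u in A, val u \in L i].
  have := Lt i (ltn_ord i); set B := [set u : U | val u \in L i].
  have -> : #|` L i|%fset = #|B|.
    rewrite cardE -(size_map val); apply/perm_size/uniq_perm.
    - exact: fset_uniq.
    - by rewrite map_inj_uniq ?enum_uniq //; exact: val_inj.
    move=> c; apply/idP/mapP => [cL|[u + ->]]; last by rewrite mem_enum inE.
    have cU : c \in U := fsubsetP (LU i (ltn_ord i)) _ cL.
    by exists [` cU]%fset; rewrite ?mem_enum ?inE.
  case/card_geqP => s [us ss sB]; exists [set u in s].
  rewrite cardsE (card_uniqP us) ss eqxx /=; apply/forall_inP => u.
  by rewrite inE => /sB; rewrite inE.
pose A i := xchoose (LA i).
have AP i := andP (xchooseP (LA i)).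
have := @momentE _ _ x x_inj n A (t0 :: t) (fun i => eqP (AP i).1) E
  (fun=> 0) (t0 :: t) En.
rewrite big1 // add0n => /(_ _ (fun=> erefl)) mE.
have {}mE : moment x A (fun=> 0) E != 0%R.
  rewrite mE ?intr_eq0 // Et sumnE (big_nth 0) big_mkord //.
have [c cA cE] : exists2 c : {ffun 'I_n.+1 -> U},
    c \in family (fun i => mem (A i)) &
    (\prod_(e <- E) (x (c (inord e.1)) - x (c (inord e.2))) != 0)%R.
  apply/exists_inP; apply: contraNT mE => /exists_inPn H.
  rewrite /moment big1 // => c /H; rewrite negbK => /eqP ->.
  by rewrite mulr0.
exists (fun i => val (c (inord i))); split=> [i ni|e eE].
  have := familyP cA (inord i); have /forall_inP AL := (AP (inord i)).2.
  by move/AL; rewrite inordK.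
rewrite prodf_seq_neq0 in cE; have /= := allP cE _ eE.
by rewrite subr_eq0 (inj_eq x_inj).
Qed.

(** * Configurations encoded for evaluation *)

(* A list [fl] of flags is encoded by pairs (tail, head) of vertex indices. *)
Definition conflict_pattern (f g : nat * nat) : bool :=
  [|| f.1 == g.1, f.2 == g.1 | f.1 == g.2].

(** Each conflict is listed once, smaller index first, and so gives one factor of the product. *)
Definition pattern_edges (fl : seq (nat * nat)) : seq (nat * nat) :=
  [seq kl <- [seq (k, l) | l <- iota 0 (size fl), k <- iota 0 l] |
    conflict_pattern (nth (0, 0) fl kl.1) (nth (0, 0) fl kl.2)].

(** Bounds the number of flags outside [fl] with tail [m]. *)
Definition free_slots (d : seq nat) (fl : seq (nat * nat)) (m : nat) : nat :=
  nth 0 d m - count (fun f => f.1 == m) fl.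

(* A flag outside [fl] in conflict with [f] has its tail at the tail of [f], its
   head there, or its tail at the head of [f]. The case [f.1 == f.2] encodes a
   pendant edge, which has only one flag. *)
Definition outer_bound (d : seq nat) (fl : seq (nat * nat)) (f : nat * nat) :=
  2 * free_slots d fl f.1 +
  (if f.1 == f.2 then 0 else free_slots d fl f.2).

(* [d] bounds the degrees of the vertices, and [t] is an exponent vector. *)
Definition reducible (d : seq nat) (fl : seq (nat * nat)) (t : seq nat) :=
  let E := pattern_edges fl in
  [&& 0 < size t, size t == size fl,
      all (fun f => (f.1 < size d) && (f.2 < size d)) fl,
      all (fun k => outer_bound d fl (nth (0, 0) fl k) + nth 0 t k < 6)
        (iota 0 (size fl)),
      all (fun e => (e.1 < size t) && (e.2 < size t)) E,
      size E == sumn t & orientation_coef E t != 0%R].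

(** * Flags and their conflicts *)

Section Flags.
(* The flag [i] lies on the edge [ea i] and has tail [vb i]. *)
Variables (I V W : finType) (ea : I -> V) (vb : I -> W).
Hypothesis flag_inj : forall i j, ea i = ea j -> vb i = vb j -> i = j.
Hypothesis ea_deg : forall a, #|[set i | ea i == a]| <= 2.
Hypothesis vb_deg : forall b, #|[set i | vb i == b]| <= 3.

(** In [G]: the two edges share an end or some edge [k] joins them, so no induced matching contains
    both. *)
Definition flag_conflict (i j : I) : bool :=
  (i != j) &&
  [|| ea i == ea j, vb i == vb j |
    [exists k, (ea k == ea i) && (vb k == vb j)
            || (ea k == ea j) && (vb k == vb i)]].

Lemma flag_conflict_sym i j : flag_conflict i j = flag_conflict j i.
Proof.
rewrite /flag_conflict eq_sym [ea i == _]eq_sym [vb i == _]eq_sym.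
by congr [&& _ & [|| _, _ | _]]; apply: eq_existsb => k; rewrite orbC.
Qed.

(* The other flag of the same edge, or [i] itself if the edge is pendant. *)
Definition mate (i : I) : I :=
  if [pick j | (j != i) && (ea j == ea i)] is Some j then j else i.

Lemma ea_mate i : ea (mate i) = ea i.
Proof. by rewrite /mate; case: pickP => // j /andP[_ /eqP]. Qed.

Lemma ea_eqP i j : ea j = ea i -> j = i \/ j = mate i.
Proof.
move=> ij; case: (eqVneq j i) => [->|ji]; [by left | right].
rewrite /mate; case: pickP => [k /andP[ki /eqP eki]|/(_ j)]; last first.
  by rewrite ji ij eqxx.
apply/eqP; apply: contraTT (ea_deg (ea i)) => jk; rewrite -ltnNge.
apply: leq_trans (subset_leq_card (_ : [set i; j; k] \subset _)).
  rewrite setUC cardsU1 cards2 !inE [i == j]eq_sym ji negb_or ki.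
  by rewrite [k == j]eq_sym jk.
by apply/subsetP => l; rewrite !inE => /orP[/orP[]|] /eqP ->; rewrite ?ij ?eki.
Qed.

Lemma mateK : involutive mate.
Proof.
move=> i; case: (ea_eqP (esym (ea_mate i))) => [ir|<- //].
by rewrite -!ir.
Qed.

Lemma vb_mate_neq i : mate i != i -> vb (mate i) != vb i.
Proof. by apply: contra => /eqP/flag_inj -> //; rewrite ea_mate. Qed.

(** By [ea_eqP] a joining flag [k] is one of [i], [j] or their mates, so tails and heads suffice. *)
Lemma flag_conflictP i j : flag_conflict i j ->
  [\/ vb j = vb i, vb j = vb (mate i) | vb (mate j) = vb i].
Proof.
case/andP=> ij /or3P[/eqP/esym/ea_eqP[ji|->]|/eqP ->|/existsP[k]].
- by rewrite ji eqxx in ij.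
- exact: Or32.
- exact: Or31.
case/orP=> /andP[/eqP/ea_eqP[]-> /eqP].
- by move=> ->; apply: Or31.
- by move=> <-; apply: Or32.
- by move=> ->; apply: Or31.
- exact: Or33.
Qed.

(** * Extending partial colourings *)

Variables (C : choiceType) (L : I -> {fset C}).
Hypothesis L6 : forall i, 6 <= #|` L i|%fset.

Definition colorable (Y : {set I}) : Prop :=
  exists phi : I -> C, (forall i, i \in Y -> phi i \in L i) /\
    {in Y &, forall i j, flag_conflict i j -> phi i != phi j}.

(** The removed flags are [s], and [o k] covers the coloured flags in conflict with the [k]-th.
    Deleting their colours from its list leaves more than [nth 0 t k], so [alon_tarsi] applies. *)
Lemma colorable_extend (Y : {set I}) (s : seq I) (o : nat -> seq I)
    (E : seq (nat * nat)) (t : seq nat) :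
  0 < size t -> size t = size s ->
  all (fun e => (e.1 < size t) && (e.2 < size t)) E ->
  size E = sumn t -> orientation_coef E t != 0%R ->
  (forall i0 k, k < size s -> size (o k) + nth 0 t k < 6 /\
    forall j, j \in Y -> j \notin s -> flag_conflict (nth i0 s k) j ->
      j \in o k) ->
  (forall i0 k l, k < l -> l < size s ->
    flag_conflict (nth i0 s k) (nth i0 s l) -> (k, l) \in E) ->
  colorable [set i in Y | i \notin s] -> colorable Y.
Proof.
move=> t0 ts Et sE coef oP EP [phi [phiL phiC]].
have i0 : I by case: s ts {oP EP phiL phiC} => [ts|i //]; rewrite ts in t0.
pose L' k := (L (nth i0 s k) `\` [fset c in map phi (o k)])%fset.
have [|c [cL cE]] := @alon_tarsi _ L' E t t0 Et sE coef.
  move=> k; rewrite ts => ks; have [ok _] := oP i0 k ks.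
  rewrite cardfsD ltn_subRL.
  apply: leq_trans (L6 _); apply: leq_trans ok.
  rewrite ltnS leq_add2r.
  apply: leq_trans (fsubset_leq_card (fsubsetIr _ _)) _.
  by rewrite card_fseq (leq_trans (size_undup _)) ?size_map.
exists (fun i => if i \in s then c (index i s) else phi i); split.
  move=> i iY; case: ifPn => [is_|is_]; last by apply: phiL; rewrite inE iY.
  have := cL (index i s); rewrite ts index_mem => /(_ is_).
  by rewrite inE nth_index // => /andP[].
have cross i j : i \in s -> j \in Y -> j \notin s -> flag_conflict i j ->
    c (index i s) != phi j.
  move=> is_ jY js ij; have ks : index i s < size s by rewrite index_mem.
  have := cL (index i s); rewrite ts => /(_ ks).
  rewrite inE => /andP[+ _]; apply: contraNneq => ->.
  rewrite inE; apply/map_f/(oP i0 _ ks).2 => //.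
  by rewrite nth_index.
have inner i j : i \in s -> j \in s -> index i s < index j s ->
    flag_conflict i j -> c (index i s) != c (index j s).
  move=> is_ js lt_ij ij; apply: (cE (_, _)); apply: (EP i0) => //.
    by rewrite index_mem.
  by rewrite !nth_index.
move=> i j iY jY ij; case: ifPn => is_; case: ifPn => js.
- case: (ltngtP (index i s) (index j s)) => lt_ij.
  + exact: inner.
  + by rewrite eq_sym inner // flag_conflict_sym.
  + move: ij; rewrite -(nth_index i0 is_) lt_ij nth_index //.
    by rewrite /flag_conflict eqxx.
- exact: cross.
- by rewrite eq_sym cross // flag_conflict_sym.
- by apply: phiC; rewrite ?inE ?iY ?jY.
Qed.

Definition mate_closed (Y : {set I}) : Prop :=
  forall i, i \in Y -> mate i \in Y.

(** As the vertices in [vs] are distinct, comparing vertices amounts to comparing indices, so the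
    checks of [reducible] on [fl] carry over to [s]. *)
Lemma colorable_reduce (Y : {set I}) (w0 : W) (s : seq I) (vs : seq W)
    (d : seq nat) (fl : seq (nat * nat)) (t : seq nat) :
  (forall Z : {set I}, #|Z| < #|Y| -> mate_closed Z -> colorable Z) ->
  mate_closed Y -> {subset s <= Y} -> uniq s -> all (fun i => mate i \in s) s ->
  uniq vs -> size vs = size d ->
  [seq (vb i, vb (mate i)) | i <- s] =
    [seq (nth w0 vs f.1, nth w0 vs f.2) | f <- fl] ->
  (forall m, m < size d ->
    #|[set i in Y | vb i == nth w0 vs m]| <= nth 0 d m) ->
  reducible d fl t -> colorable Y.
Proof.
move=> IH Yr sY us /allP sr uvs vsd s_fl dP /and5P[t0 /eqP tfl /allP fld].
move=> /allP bound /and3P[Et /eqP sE coef].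
have sfl : size s = size fl.
  by have := congr1 size s_fl; rewrite !size_map.
have nth_s i0 k : k < size s ->
    vb (nth i0 s k) = nth w0 vs (nth (0, 0) fl k).1 /\
    vb (mate (nth i0 s k)) = nth w0 vs (nth (0, 0) fl k).2.
  move=> ks; have := congr1 (fun p => nth (w0, w0) p k) s_fl.
  by rewrite (nth_map i0) // (nth_map (0, 0)) -?sfl // => -[].
have fl_lt k : k < size s ->
    (nth (0, 0) fl k).1 < size vs /\ (nth (0, 0) fl k).2 < size vs.
  by rewrite sfl vsd => /(mem_nth (0, 0)) /fld /andP[].
have nth_fl i0 k l : k < size s -> l < size s ->
  [/\ (vb (nth i0 s k) == vb (nth i0 s l)) =
        ((nth (0, 0) fl k).1 == (nth (0, 0) fl l).1),
      (vb (nth i0 s k) == vb (mate (nth i0 s l))) =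
        ((nth (0, 0) fl k).1 == (nth (0, 0) fl l).2) &
      (vb (mate (nth i0 s k)) == vb (nth i0 s l)) =
        ((nth (0, 0) fl k).2 == (nth (0, 0) fl l).1)].
  move=> ks ls; have [k1 k2] := fl_lt k ks; have [l1 l2] := fl_lt l ls.
  by split; rewrite ?(nth_s i0 _ ks).1 ?(nth_s i0 _ ks).2 ?(nth_s i0 _ ls).1
     ?(nth_s i0 _ ls).2 nth_uniq.
pose out m := [seq i <- enum Y | (vb i == nth w0 vs m) && (i \notin s)].
have size_out m : m < size d -> size (out m) <= free_slots d fl m.
  move=> md; rewrite /free_slots.
  have <- : count (fun i => vb i == nth w0 vs m) s
      = count (fun f => f.1 == m) fl.
    transitivity (count (fun p => p.1 == nth w0 vs m)
        [seq (vb i, vb (mate i)) | i <- s]); first by rewrite count_map.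
    rewrite s_fl count_map; apply: eq_in_count => f /fld /andP[f1 _] /=.
    by rewrite nth_uniq // vsd.
  suff le_d :
      count (fun i => vb i == nth w0 vs m) s + size (out m) <= nth 0 d m.
    by rewrite leq_subRL // (leq_trans (leq_addr _ _) le_d).
  apply: leq_trans (dP m md); rewrite -size_filter -size_cat cardE.
  apply: uniq_leq_size => [|i].
    rewrite cat_uniq filter_uniq //= /out filter_uniq ?enum_uniq // andbT.
    apply/hasPn => i; rewrite !mem_filter => /andP[/andP[_ /negbTE ->]].
    by rewrite andbF.
  rewrite mem_enum inE mem_cat /out mem_filter (mem_filter _ _ (enum _)).
  rewrite mem_enum => /orP[/andP[-> /sY ->]|] //.
  by case/andP=> /andP[-> _] ->.
have mem_out m j : j \in Y -> j \notin s -> vb j = nth w0 vs m -> j \in out m.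
  by move=> jY js jm; rewrite mem_filter jm eqxx js mem_enum.
have rs j : j \notin s -> mate j \notin s.
  by apply: contra => /sr; rewrite mateK.
(* In order: outer flags with the tail of [f], with tail at its head, and with head at its tail. For
   a pendant edge the second kind would repeat the first. *)
pose o k := let f := nth (0, 0) fl k in
  out f.1 ++ (if f.1 == f.2 then [::] else out f.2) ++ map mate (out f.1).
apply: (@colorable_extend Y s o (pattern_edges fl) t) => //.
- by rewrite tfl.
- move=> i0 k ks; split.
    have kfl : k \in iota 0 (size fl) by rewrite mem_iota -sfl.
    apply: leq_trans (bound _ kfl); rewrite ltnS leq_add2r.
    have [f1 f2] := fl_lt k ks; rewrite vsd in f1 f2.
    rewrite /o /outer_bound !size_cat size_map mulSn mul1n -addnA.
    rewrite leq_add ?size_out //.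
    rewrite addnC leq_add ?size_out //.
    by case: eqP => // _; apply: size_out.
  move=> j jY js /flag_conflictP.
  have [-> ->] := nth_s i0 k ks; rewrite !mem_cat => -[jm|jm|jm].
  + by rewrite mem_out.
  + by case: eqP => [f12|_]; [rewrite -f12 in jm|];
       rewrite (mem_out _ _ jY js jm) ?orbT.
  + apply/orP; right; apply/orP; right.
    by rewrite -[j]mateK map_f // mem_out ?rs //; apply: Yr.
- move=> i0 k l kl ls /flag_conflictP cf; have ks := ltn_trans kl ls.
  rewrite mem_filter; apply/andP; split.
    have [e1 e2 e3] := nth_fl i0 k l ks ls.
    rewrite /conflict_pattern /= -e1 -e2 -e3.
    by case: cf => ->; rewrite eqxx ?orbT.
  by apply/allpairsPdep; exists l, k; rewrite !mem_iota -sfl.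
apply: IH.
  have ls : 0 < size s by rewrite sfl -tfl.
  have [i is_] : exists i, i \in s.
    by case: (s) ls => // i s' _; exists i; rewrite mem_head.
  apply: proper_card; apply/properP; split.
    by apply/subsetP => j; rewrite inE => /andP[].
  by exists i; rewrite ?sY // inE is_ andbF.
by move=> i; rewrite !inE => /andP[/Yr -> /rs].
Qed.

Lemma flags_uniq (w0 : W) (s : seq I) (vs : seq W) (fl : seq (nat * nat)) :
  uniq vs -> uniq fl -> all (fun f => (f.1 < size vs) && (f.2 < size vs)) fl ->
  [seq (vb i, vb (mate i)) | i <- s] =
    [seq (nth w0 vs f.1, nth w0 vs f.2) | f <- fl] -> uniq s.
Proof.
move=> uvs ufl /allP fl_lt s_fl.
apply: (map_uniq (f := fun i => (vb i, vb (mate i)))).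
rewrite s_fl map_inj_in_uniq // => -[k l] [k' l'] /fl_lt /andP[/= k_lt l_lt].
case/fl_lt/andP=> /= k'_lt l'_lt [/eqP + /eqP].
by rewrite !nth_uniq // => /eqP -> /eqP ->.
Qed.

Lemma third_flag (Y : {set I}) i j :
  2 < #|[set k in Y | vb k == vb i]| ->
  exists k, [/\ k \in Y, vb k = vb i, k != i & k != j].
Proof.
move=> c3.
have /subsetPn[k] : ~~ ([set k in Y | vb k == vb i] \subset [set i; j]).
  apply: contraTN c3 => /subset_leq_card c2; rewrite -leqNgt.
  by rewrite (leq_trans c2) // cards2; case: (i != j).
rewrite !inE negb_or => /andP[kY /eqP ki] /andP[k1 k2].
by exists k.
Qed.

(** * The induction over reducible configurations *)

Lemma colorable_mate_closed (Y : {set I}) : mate_closed Y -> colorable Y.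
Proof.
elim: {Y}_.+1 {-2}Y (ltnSn #|Y|) => // n IHn Y; rewrite ltnS => Yn Yr.
have {IHn Yn} IH (Z : {set I}) : #|Z| < #|Y| -> mate_closed Z -> colorable Z.
  by move=> ZY; apply: IHn; apply: leq_trans Yn.
have deg3 w : #|[set i in Y | vb i == w]| <= 3.
  apply: leq_trans (vb_deg w); apply: subset_leq_card.
  by apply/subsetP => i; rewrite !inE => /andP[].
have [->|[i0 i0Y]] := set_0Vmem Y.
  have L0 i : exists c, c \in L i.
    by apply/fset0Pn; rewrite -cardfs_gt0; apply: leq_trans (L6 i).
  by exists (fun i => xchoose (L0 i)); split=> i; rewrite inE.
have reduce s vs d fl t := @colorable_reduce Y (vb i0) s vs d fl t IH Yr.
have [lone|] := boolP [exists i in Y, mate i == i].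
  case/exists_inP: lone => i iY /eqP ri.
  apply: (reduce [:: i] [:: vb i] [:: 3] [:: (0, 0)] [:: 0]) => //=.
  - by move=> j; rewrite inE => /eqP ->.
  - by rewrite ri inE eqxx.
  - by rewrite ri.
  - by case.
move=> /exists_inPn mate_neq.
have vb_neq i : i \in Y -> vb (mate i) != vb i.
  by move=> /mate_neq; apply: vb_mate_neq.
(* At most 2 * 1 + 2 outer conflicts at the low end and 2 * 2 + 1 for the mate leave at least 2 and
   1 colours. *)
have [low|] := boolP [exists i in Y, #|[set k in Y | vb k == vb i]| <= 2].
  case/exists_inP: low => i iY low.
  apply: (reduce [:: i; mate i] [:: vb i; vb (mate i)] [:: 2; 3]
    [:: (0, 1); (1, 0)] [:: 1; 0]) => //=.
  - by move=> j; rewrite !inE => /orP[] /eqP -> //; apply: Yr.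
  - by rewrite inE eq_sym mate_neq.
  - by rewrite mateK !inE !eqxx orbT.
  - by rewrite inE eq_sym vb_neq.
  - by rewrite mateK.
  - by case=> [|[]].
move=> /exists_inPn cubic.
have third i j : i \in Y ->
    exists k, [/\ k \in Y, vb k = vb i, k != i & k != j].
  by move=> /cubic; rewrite -ltnNge => /third_flag.
have [par|] := boolP [exists i in Y, exists j in Y,
    [&& i != j, vb i == vb j & vb (mate i) == vb (mate j)]].
  case/exists_inP: par => i iY /exists_inP[j jY /and3P[ij /eqP vij /eqP vrij]].
  have [k [kY vk ki kj]] := third i j iY.
  have sY : {subset [:: i; j; k; mate i; mate j; mate k] <= Y}.
    by apply/allP; rewrite /= iY jY kY !Yr.
  have mate_at x y : vb x = vb i -> vb y = vb i -> y \in Y ->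
      (x == mate y) = false.
    by move=> xi yi /vb_neq; rewrite yi -xi; apply: contraNF => /eqP <-.
  (* Parallel edges share both ends, so distinctness does not follow from [flags_uniq]. *)
  have us : uniq [:: i; j; k; mate i; mate j; mate k].
    rewrite /= !inE !(inj_eq (inv_inj mateK)) !mate_at //.
    rewrite [i == k]eq_sym [j == k]eq_sym.
    by rewrite (negbTE ij) (negbTE ki) (negbTE kj).
  (* With three parallel edges the six flags conflict pairwise and have no outer conflicts: a
     Vandermonde product, exponents 0 to 5. *)
  have [vrk|vrk] := eqVneq (vb (mate k)) (vb (mate i)).
    apply: (reduce [:: i; j; k; mate i; mate j; mate k] [:: vb i; vb (mate i)]
      [:: 3; 3] [:: (0, 1); (0, 1); (0, 1); (1, 0); (1, 0); (1, 0)]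
      (iota 0 6)) => //.
    - by rewrite /= !inE !mateK !eqxx !orbT.
    - by rewrite /= inE eq_sym vb_neq.
    - by rewrite /= !mateK -vrij vrk vk -vij.
    - by case=> [|[]].
  (* Outer conflicts allow exponents up to 4, 4, 3, 3, 3, 1. Of the 15 pairs, the two entering
     [vb i] from different vertices do not conflict. *)
  apply: (reduce [:: i; j; k; mate i; mate j; mate k]
    [:: vb i; vb (mate i); vb (mate k)] [:: 3; 3; 3]
    [:: (0, 1); (0, 1); (0, 2); (1, 0); (1, 0); (2, 0)]
    [:: 1; 4; 2; 2; 3; 1]) => //.
  - by rewrite /= !inE !mateK !eqxx !orbT.
  - rewrite /= !inE !(eq_sym (vb i)) negb_or vb_neq // -vk vb_neq //=.
    by rewrite eq_sym vrk.
  - by rewrite /= !mateK -vrij vk -vij.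
  - by case=> [|[|[]]].
move=> par.
have simple i j : i \in Y -> j \in Y -> vb i = vb j ->
    vb (mate i) = vb (mate j) -> i = j.
  move=> iY jY ij rij; apply: contraNeq par => ne.
  apply/exists_inP; exists i => //; apply/exists_inP; exists j => //.
  by rewrite ne ij rij !eqxx.
have [tri|] := boolP [exists i in Y, exists j in Y, exists k in Y,
    [&& vb (mate i) == vb j, vb (mate j) == vb k & vb (mate k) == vb i]].
  case/exists_inP: tri => i iY /exists_inP[j jY /exists_inP[k kY]].
  case/and3P=> /eqP ij /eqP jk /eqP ki.
  have nij : vb i != vb j by rewrite eq_sym -ij vb_neq.
  have njk : vb j != vb k by rewrite eq_sym -jk vb_neq.
  have nik : vb i != vb k by rewrite -ki vb_neq.
  have uvs : uniq [:: vb i; vb j; vb k] by rewrite /= !inE negb_or nij nik njk.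
  (* Each flag has at most 2 + 1 outer conflicts. Only flags with a common head do not conflict, so
     the conflict graph is an octahedron; 2 is half its degree. *)
  apply: (reduce [:: i; j; k; mate i; mate j; mate k] [:: vb i; vb j; vb k]
    [:: 3; 3; 3] [:: (0, 1); (1, 2); (2, 0); (1, 0); (2, 1); (0, 2)]
    (nseq 6 2)) => //.
  - by apply/allP; rewrite /= iY jY kY !Yr.
  - apply: (flags_uniq (w0 := vb i) uvs
      (fl := [:: (0, 1); (1, 2); (2, 0); (1, 0); (2, 1); (0, 2)])) => //.
    by rewrite /= !mateK ij jk ki.
  - by rewrite /= !inE !mateK !eqxx !orbT.
  - by rewrite /= !mateK ij jk ki.
  - by case=> [|[|[]]].
move=> ntri.
have triangle_free i j k : i \in Y -> j \in Y -> k \in Y ->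
    vb (mate i) = vb j -> vb (mate j) = vb k -> vb (mate k) != vb i.
  move=> iY jY kY ij jk; apply: contra ntri => ki.
  apply/exists_inP; exists i => //; apply/exists_inP; exists j => //.
  by apply/exists_inP; exists k => //; rewrite ij jk ki !eqxx.
(* The central edge has flags [g] and [h]; [a], [b] are the other flags at the tail of [g], and [c],
   [d] those at the tail of [h]. *)
pose g := i0; have gY : g \in Y := i0Y.
pose h := mate g; have hY : h \in Y by apply: Yr.
have [a [aY ag a_g _]] := third g g gY.
have [b [bY bg b_g b_a]] := third g a gY.
have [c [cY ch c_h _]] := third h h hY.
have [d [dY dh d_h d_c]] := third h c hY.
have uvs : uniq [:: vb g; vb h; vb (mate a); vb (mate b); vb (mate c);
    vb (mate d)].
  have hg : vb (mate h) = vb g by rewrite mateK.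
  have simple_neq x y : x \in Y -> y \in Y -> vb y = vb x -> y != x ->
      vb (mate x) != vb (mate y).
    by move=> xY yY yx; apply: contraNneq => rxy; apply/eqP/simple.
  (* A common neighbour of the two central vertices would close a triangle. *)
  have cross x y : x \in Y -> y \in Y -> vb x = vb g -> vb y = vb h ->
      vb (mate x) != vb (mate y).
    move=> xY yY xg yh.
    have := @triangle_free g y (mate x) gY yY (Yr _ xY) (esym yh).
    by rewrite mateK xg => tf; apply/eqP => /esym/tf; rewrite eqxx.
  have ngh : vb g != vb h by rewrite eq_sym vb_neq.
  have nga : vb g != vb (mate a) by rewrite eq_sym -ag vb_neq.
  have ngb : vb g != vb (mate b) by rewrite eq_sym -bg vb_neq.
  have nhc : vb h != vb (mate c) by rewrite eq_sym -ch vb_neq.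
  have nhd : vb h != vb (mate d) by rewrite eq_sym -dh vb_neq.
  have ngc : vb g != vb (mate c) by rewrite -hg simple_neq.
  have ngd : vb g != vb (mate d) by rewrite -hg simple_neq.
  have nha : vb h != vb (mate a) by rewrite simple_neq.
  have nhb : vb h != vb (mate b) by rewrite simple_neq.
  have nab : vb (mate a) != vb (mate b) by rewrite simple_neq // ag.
  have ncd : vb (mate c) != vb (mate d) by rewrite simple_neq // ch.
  rewrite /= !inE !negb_or ngh nga ngb ngc ngd nha nhb nhc nhd nab ncd.
  by rewrite !cross.
(* Flags leaving a leaf have at most 4 outer conflicts, flags entering one 2, central flags none:
   exponents up to 1, 3 and 5 are allowed. Those chosen sum to 23, the number of conflicts. *)
apply: (reduce [:: mate a; mate b; a; b; mate c; mate d; c; d; g; h]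
  [:: vb g; vb h; vb (mate a); vb (mate b); vb (mate c); vb (mate d)] (nseq 6 3)
  [:: (2, 0); (3, 0); (0, 2); (0, 3); (4, 1); (5, 1); (1, 4); (1, 5);
    (0, 1); (1, 0)]
  [:: 1; 0; 2; 3; 1; 1; 2; 3; 5; 5]) => //.
- by apply/allP; rewrite /= aY bY cY dY gY hY !Yr.
- apply: (flags_uniq (w0 := vb g) uvs (fl := [:: (2, 0); (3, 0); (0, 2); (0, 3);
    (4, 1); (5, 1); (1, 4); (1, 5); (0, 1); (1, 0)])) => //.
  by rewrite /= /h !mateK ag bg ch dh.
- by rewrite /= !inE !mateK !eqxx !orbT.
- by rewrite /= /h !mateK ag bg ch dh.
- by case=> [|[|[|[|[|[]]]]]].
Qed.
End Flags.

(** * From colourings of flags to strong edge colourings *)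

Theorem theorem1p4 (G : sgraph) (hG : bipartite23 G) :
  list_strong_chromatic_index G <= 6.
Proof.
case: hG => A [B [[AB dAB cross] /bigmax_leqP dA /bigmax_leqP dB]].
(* Splitting each edge into its end in [A] and its end in [B] gives [ea] and [vb]. *)
have ends (f : edge G) : exists ab : G * G,
    [&& adj ab.1 ab.2, ab.1 \in A, ab.2 \in B & val f == [set ab.1; ab.2]].
  have := valP f; rewrite inE => /existsP[x /existsP[y /andP[xy /eqP fxy]]].
  case: (cross x y xy) => /andP[xA yB]; [exists (x, y)|exists (y, x)].
    by rewrite /= xy xA yB fxy eqxx.
  by rewrite /= adj_sym xy xA yB fxy setUC eqxx.
pose ea f := (xchoose (ends f)).1; pose vb f := (xchoose (ends f)).2.
have endsP f :
    [/\ adj (ea f) (vb f), ea f \in A, vb f \in B & val f = [set ea f; vb f]].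
  by have /and4P[? ? ? /eqP ?] := xchooseP (ends f); split.
have flag_inj f g : ea f = ea g -> vb f = vb g -> f = g.
  move=> efg vfg; apply: val_inj.
  by case: (endsP f) (endsP g) => _ _ _ -> [_ _ _ ->]; rewrite efg vfg.
have ea_deg a : #|[set f | ea f == a]| <= 2.
  have [->|[f fa]] := set_0Vmem [set f | ea f == a]; first by rewrite cards0.
  have aA : a \in A by move: fa; rewrite inE => /eqP <-; case: (endsP f).
  apply: leq_trans (dA a aA); rewrite -(card_in_imset (f := vb)).
    apply/subset_leq_card/subsetP => _ /imsetP[g + ->]; rewrite !inE => /eqP <-.
    by case: (endsP g).
  by move=> g h; rewrite !inE => /eqP ga /eqP ha; apply: flag_inj;
    rewrite ga ha.
have vb_deg b : #|[set f | vb f == b]| <= 3.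
  have [->|[f fb]] := set_0Vmem [set f | vb f == b]; first by rewrite cards0.
  have bB : b \in B by move: fb; rewrite inE => /eqP <-; case: (endsP f).
  apply: leq_trans (dB b bB); rewrite -(card_in_imset (f := ea)).
    apply/subset_leq_card/subsetP => _ /imsetP[g + ->]; rewrite !inE => /eqP <-.
    by rewrite adj_sym; case: (endsP g).
  by move=> g h; rewrite !inE => /eqP gb /eqP hb gh; apply: flag_inj;
    rewrite ?gb ?hb.
have AB0 a b : a \in A -> b \in B -> a != b.
  move=> aA bB; apply: contraTneq aA => ->.
  by rewrite (disjointFl dAB).
apply: (list_strong_chromatic_indexP G).2 => C L L6.
have [|phi [phiL phiC]] :=
  colorable_mate_closed flag_inj ea_deg vb_deg L6 (Y := setT).
  by move=> f; rewrite !inE.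
exists phi; split; last by move=> f; apply: phiL; rewrite inE.
have {}phiC f g : phi f = phi g -> f != g ->
    [/\ ea f != ea g, vb f != vb g &
        forall k, ea k = ea f -> vb k <> vb g].
  move=> fg nfg; have : ~~ flag_conflict ea vb f g.
    by apply: contraPN fg => /phiC; rewrite !inE => /(_ isT isT) /eqP.
  rewrite /flag_conflict nfg /= !negb_or => /and3P[-> -> /existsPn nk].
  split=> // k kf kg.
  by have := nk k; rewrite kf kg !eqxx.
move=> c; split; first split.
- by apply/subsetP => _ /imsetP[f _ ->]; apply: valP.
- apply/trivIsetP => _ _ /imsetP[f + ->] /imsetP[g + ->].
  rewrite !inE => /eqP fc /eqP gc nfg.
  have {}nfg : f != g by apply: contraNneq nfg => ->.
  have [nea nvb _] := phiC f g (etrans fc (esym gc)) nfg.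
  have [_ fA fB ->] := endsP f; have [_ gA gB ->] := endsP g.
  rewrite disjoints_subset; apply/subsetP => x; rewrite !inE negb_or.
  case/orP=> /eqP ->; first by rewrite nea AB0.
  by rewrite nvb eq_sym AB0.
(* The ends of [f] lie on edges [g] and [h] of colour [c]. If these coincide, they equal [f];
   otherwise [f] joins them, so they conflict. *)
- move=> f0 f0E; pose f : edge G := exist _ f0 f0E; rewrite -[f0]/(val f).
  have [_ fA fB vf] := endsP f; rewrite {1}vf => /subsetP fsub.
  have /bigcupP[_ /imsetP[g + ->]] := fsub (ea f) (set21 _ _).
  have /bigcupP[_ /imsetP[h + ->]] := fsub (vb f) (set22 _ _).
  have [_ gA gB ->] := endsP g; have [_ hA hB ->] := endsP h.
  rewrite !inE => /eqP hc fh /eqP gc fg.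
  have {}fg : ea f = ea g.
    by case/orP: fg => /eqP // ef; have := AB0 _ _ fA gB; rewrite ef eqxx.
  have {}fh : vb f = vb h.
    by case/orP: fh => /eqP // ef; have := AB0 _ _ hA fB; rewrite ef eqxx.
  case: (eqVneq g h) => [gh|ngh].
    by apply: imset_f; rewrite inE -gc (flag_inj f g) // fh gh.
  by have [_ _ /(_ f fg)] := phiC g h (etrans gc (esym hc)) ngh.
Qed.
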